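(* Let $\mathbb K$ be an algebraically closed field of characteristic $p>0$, let $A$ be an $n\times n$ matrix over $\mathbb K$ with $\operatorname{rk}(A)=n-1$, let parities of the Chevalley generators be fixed, and let $\mathfrak g=\mathfrak g(A)$ be the Lie (super)algebra with Cartan matrix $A$ and maximal torus $\mathfrak h$. Let $z\in\mathfrak h$ be a non-zero central element of $\mathfrak g$ and let $D\in\mathfrak h$, $D\notin\mathfrak g^{(1)}$, be a grading element, so that $\mathfrak g=\mathfrak g^{(1)}\ltimes\mathbb K D$ is a semi-direct sum. Then the linear operator $M:\mathfrak g\to\mathfrak g$ defined by $$M(D)=z,\qquad M(\mathfrak g^{(1)})=0$$ is an outer derivation of $\mathfrak g$, i.e., $M$ is a derivation and there is no $x\in\mathfrak g$ with $M=\operatorname{ad}_x$.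
   Context: Lie superalgebras: for $p=3$ one also requires $[x,[x,x]]=0$ for odd $x$. For $p=2$, a Lie superalgebra is a $\mathbb Z/2$-graded space $\mathfrak g=\mathfrak g_{\bar0}\oplus\mathfrak g_{\bar1}$ such that $\mathfrak g_{\bar 0}$ is a Lie algebra, $\mathfrak g_{\bar1}$ is a $\mathfrak g_{\bar0}$-module, and there is a squaring $x\mapsto x^2$, $\mathfrak g_{\bar1}\to\mathfrak g_{\bar0}$, with $(ax)^2=a^2x^2$ for $a\in\mathbb K$, with $[x,y]:=(x+y)^2-x^2-y^2$ bilinear on $\mathfrak g_{\bar1}$, and with $[x^2,y]=[x,[x,y]]$ for all $x\in\mathfrak g_{\bar1}$, $y\in\mathfrak g$. A derivation for $p=2$ must in addition satisfy $D(x^2)=[Dx,x]$ for odd $x$. $\mathfrak g^{(1)}$ is the derived algebra (the span of all brackets and, for $p=2$, also of all squares of odd elements). The algebra $\mathfrak g(A)$: let $\mathfrak h$ be an (even) vector space of dimension $2n-\operatorname{rk}A$ with linearly independent $h_1,\dots,h_n\in\mathfrak h$ and linearly independent $\alpha_1,\dots,\alpha_n\in\mathfrak h^*$ such that $\alpha_j(h_i)=A_{ij}$. Let $\tilde{\mathfrak g}(A)$ be the Lie (super)algebra generated by $\mathfrak h$ and elements $x_i,y_i$ (both of the prescribed parity $p_i$), $i=1,\dots,n$, subject to $[\mathfrak h,\mathfrak h]=0$, $[h,x_j]=\alpha_j(h)x_j$, $[h,y_j]=-\alpha_j(h)y_j$, $[x_i,y_j]=\delta_{ij}h_i$. It is $\mathbb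 Z^n$-graded by $\deg x_i=e_i=-\deg y_i$, $\deg\mathfrak h=0$, and $\mathfrak g(A)$ is its quotient by the largest $\mathbb Z^n$-graded ideal intersecting $\mathfrak h$ trivially. A grading element is an element of $\mathfrak h$ acting on each $x_i$, $y_i$ by a scalar. *)

(* Defs.v *)
From HB Require Import structures.
From mathcomp Require Import all_boot all_order all_algebra.
From mathcomp Require Import boolp classical_sets.

Set Implicit Arguments.
Unset Strict Implicit.
Unset Printing Implicit Defensive.

Import GRing.Theory.
Local Open Scope ring_scope.
Local Open Scope quotient_scope.

(* A Z/2-graded space is encoded as a space with the projector [od] onto its  *)
(* odd part; [homog od a x] says that x is homogeneous of parity a (true is   *)
(* odd).                                                                      *)
Definition homog (V : zmodType) (od : V -> V) (a : bool) (x : V) : Prop :=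
  od x = if a then x else 0.

(* Lie superalgebras over a field of arbitrary characteristic. [bracket] is   *)
(* the bracket of the whole space. The squaring x |-> x^2 only makes sense    *)
(* for odd x; the total function [squaring] stands for the square of the odd  *)
(* part of its argument. When 2 is invertible it is no additional datum: it   *)
(* is [x, x] / 2.                                                             *)
HB.mixin Record Lmodule_isLieSuper (K : fieldType) L of GRing.Lmodule K L := {
  odd_part : L -> L;
  bracket : L -> L -> L;
  squaring : L -> L;
  odd_part_linear : linear odd_part;
  odd_part_idem : forall x, odd_part (odd_part x) = odd_part x;
  bracket_linearl : forall y, linear (bracket^~ y);
  bracket_linearr : forall x, linear (bracket x);
  bracket_homog : forall a b x y, homog odd_part a x -> homog odd_part b y ->
    homog odd_part (a (+) b) (bracket x y);
  squaring_odd_part : forall x, squaring x = squaring (odd_part x);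
  squaring_even : forall x, homog odd_part false (squaring x);
  (* characteristic different from 2 *)
  super_anticomm : 2 \notin [pchar K] -> forall a b x y,
    homog odd_part a x -> homog odd_part b y ->
    bracket x y = - ((-1) ^+ (a && b) *: bracket y x);
  super_jacobi : 2 \notin [pchar K] -> forall a b x y z,
    homog odd_part a x -> homog odd_part b y ->
    bracket x (bracket y z) =
    bracket (bracket x y) z + (-1) ^+ (a && b) *: bracket y (bracket x z);
  super_cube : 3 \in [pchar K] -> forall x, homog odd_part true x ->
    bracket x (bracket x x) = 0;
  squaring_half : 2 \notin [pchar K] -> forall x, homog odd_part true x ->
    squaring x = 2^-1 *: bracket x x;
  (* characteristic 2: even part, odd part as a module, squaring *)
  even_alternating : 2 \in [pchar K] -> forall x, homog odd_part false x ->
    bracket x x = 0;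
  even_jacobi : 2 \in [pchar K] -> forall x y z,
    homog odd_part false x -> homog odd_part false y ->
    homog odd_part false z ->
    bracket x (bracket y z) = bracket (bracket x y) z + bracket y (bracket x z);
  odd_module : 2 \in [pchar K] -> forall x y v,
    homog odd_part false x -> homog odd_part false y ->
    homog odd_part true v ->
    bracket (bracket x y) v = bracket x (bracket y v) - bracket y (bracket x v);
  mixed_anticomm : 2 \in [pchar K] -> forall x v,
    homog odd_part false x -> homog odd_part true v ->
    bracket v x = - bracket x v;
  squaring_scale : 2 \in [pchar K] -> forall c x, homog odd_part true x ->
    squaring (c *: x) = c ^+ 2 *: squaring x;
  squaring_polar : 2 \in [pchar K] -> forall x y,
    homog odd_part true x -> homog odd_part true y ->
    bracket x y = squaring (x + y) - squaring x - squaring y;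
  squaring_bracket : 2 \in [pchar K] -> forall x y, homog odd_part true x ->
    bracket (squaring x) y = bracket x (bracket x y)
}.

#[short(type="lieSuperType")]
HB.structure Definition LieSuper (K : fieldType) :=
  {L of GRing.Lmodule K L & Lmodule_isLieSuper K L}.

Declare Scope lie_scope.
Delimit Scope lie_scope with lie.
Notation "[ x ,, y ]" := (bracket x y)
  (at level 0, x at level 99, y at level 99, format "[ x ,,  y ]") : lie_scope.
Local Open Scope lie_scope.

Notation parity a x := (homog odd_part a x).

Section LieSuperTheory.
Variables (K : fieldType) (L : lieSuperType K).
Implicit Types (I H S : set L) (x y : L).

HB.instance Definition _ :=
  GRing.isLinear.Build K L L _ (@odd_part K L) odd_part_linear.
HB.instance Definition _ x :=
  GRing.isLinear.Build K L L _ (bracket x) (bracket_linearr x).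

Definition subspace S : Prop :=
  S 0 /\ forall (c : K) x y, S x -> S y -> S (c *: x + y).

Inductive lin_span (S : set L) : set L :=
| lin_span0 : lin_span S 0
| lin_spanP (c : K) x y : S x -> lin_span S y -> lin_span S (c *: x + y).

Definition sub_superalgebra H : Prop :=
  [/\ subspace H, forall x, H x -> H (odd_part x),
      forall x y, H x -> H y -> H [x ,, y] &
      forall x, H x -> H (squaring x)].

(* An ideal is a Z/2-graded subspace; it also has to be stable under the      *)
(* squaring for the quotient to inherit one.                                  *)
Definition ideal I : Prop :=
  [/\ subspace I, forall x, I x -> I (odd_part x),
      forall x y, I x -> I [x ,, y] /\ I [y ,, x] &
      forall x, I x -> I (squaring x)].

Definition derived_alg : set L :=
  lin_span (fun w => (exists x y, w = [x ,, y]) \/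
    (2 \in [pchar K] /\ exists2 x, parity true x & w = squaring x)).

Definition semidirect_sum I H : Prop :=
  [/\ ideal I, sub_superalgebra H,
      forall x, exists u v, [/\ I u, H v & x = u + v] &
      forall x, I x -> H x -> x = 0].

Definition line x : set L := fun y => exists c : K, y = c *: x.

Definition central x : Prop := forall y, [x ,, y] = 0.

Definition parity_derivation (d : bool) (M : {linear L -> L}) : Prop :=
  [/\ forall a x, parity a x -> parity (d (+) a) (M x),
      forall a x y, parity a x ->
        M [x ,, y] = [M x ,, y] + (-1) ^+ (d && a) *: [x ,, M y] &
      2 \in [pchar K] -> forall x, parity true x -> M (squaring x) = [M x ,, x]].

Definition derivation (M : {linear L -> L}) : Prop :=
  exists M0 M1 : {linear L -> L},
    [/\ parity_derivation false M0, parity_derivation true M1 &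
        forall x, M x = M0 x + M1 x].

Definition outer_derivation (M : {linear L -> L}) : Prop :=
  derivation M /\ ~ exists x, forall y, M y = [x ,, y].

Lemma brD x y z : [x ,, y + z] = [x ,, y] + [x ,, z].
Proof. exact: linearD. Qed.

Lemma brDl x y z : [x + y ,, z] = [x ,, z] + [y ,, z].
Proof. by have := bracket_linearl z 1 x y; rewrite !scale1r. Qed.

Lemma brZ c x y : [x ,, c *: y] = c *: [x ,, y].
Proof. exact: linearZ. Qed.

Lemma brZl c x y : [c *: x ,, y] = c *: [x ,, y].
Proof.
have b0 : [0 ,, y] = 0.
  by apply: (@addIr _ [0 ,, y]); rewrite -brDl !add0r.
by have := bracket_linearl y c x 0; rewrite !addr0 b0 addr0.
Qed.

Lemma parity_odd_part x : parity true (odd_part x).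
Proof. exact: odd_part_idem. Qed.

Lemma parity_even_part x : parity false (x - odd_part x).
Proof. by rewrite /homog linearB /= odd_part_idem subrr. Qed.

Lemma squaringD x y :
  squaring (x + y) = squaring x + squaring y + [odd_part x ,, odd_part y].
Proof.
rewrite (squaring_odd_part (x + y)) (squaring_odd_part x) (squaring_odd_part y).
rewrite linearD /=.
set u := odd_part x; set v := odd_part y.
have hu : parity true u := parity_odd_part x.
have hv : parity true v := parity_odd_part y.
have huv : parity true (u + v) by rewrite /homog linearD /= hu hv.
have [p2|p2] := boolP (2 \in [pchar K]).
  by rewrite (squaring_polar p2 _ _ hu hv) -[_ - _ - _]addrA -opprD [RHS]addrC subrK.
have n2 : (2 : K) != 0 by apply: contraNneq p2 => e; rewrite inE /= e eqxx.
rewrite !squaring_half // brD !brDl (super_anticomm p2 _ _ _ _ hv hu) expr1.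
rewrite scaleN1r opprK [[u ,, v] + [v ,, v]]addrC addrACA -mulr2n -scaler_nat.
by rewrite !scalerDr scalerA mulVf // scale1r.
Qed.

Lemma br0l y : [0 ,, y] = 0.
Proof. by have := brZl 0 0 y; rewrite !scale0r. Qed.

Lemma squaring0 : squaring 0 = 0 :> L.
Proof.
have := squaringD 0 0; rewrite addr0 linear0 br0l addr0 => h.
by apply: (@addIr _ (squaring 0)); rewrite add0r.
Qed.

End LieSuperTheory.

Section PropQuotient.
Variables (T : choiceType) (r : T -> T -> Prop).
Hypotheses (rr : forall x, r x x) (rs : forall x y, r x y -> r y x).
Hypothesis rt : forall x y z, r x y -> r y z -> r x z.

Definition prel : rel T := fun x y => `[< r x y >].

Lemma prel_equiv : equiv_class_of prel.
Proof.
split=> [x|x y|y x z]; first exact/asboolP.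
  by apply/asboolP/asboolP => /rs.
by move=> /asboolP xy /asboolP yz; apply/asboolP/(rt xy yz).
Qed.

Definition prel_eq : equiv_rel T := EquivRelPack prel_equiv.
Definition pquot := {eq_quot prel_eq}.
HB.instance Definition _ := Choice.on pquot.
Definition pcls (x : T) : pquot := \pi x.
Definition prep (x : pquot) : T := repr x.

Lemma prepK x : pcls (prep x) = x.
Proof. exact: reprK. Qed.

Lemma pclsP x y : pcls x = pcls y <-> r x y.
Proof.
split=> [/eqP|h]; first by rewrite /pcls eqmodE => /asboolP.
by apply/eqP; rewrite /pcls eqmodE; apply/asboolP.
Qed.

Lemma prepP x : r (prep (pcls x)) x.
Proof. by apply/pclsP; rewrite prepK. Qed.

End PropQuotient.

(* The quotient of a Lie superalgebra by an ideal. *)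
Section IdealQuotient.
Variables (K : fieldType) (L : lieSuperType K) (I : set L).
Hypothesis idealI : ideal I.

Lemma ideal0 : I 0. Proof. by case: idealI => -[]. Qed.

Lemma idealP (c : K) x y : I x -> I y -> I (c *: x + y).
Proof. by case: idealI => -[_ h] _ _ _; apply: h. Qed.

Lemma idealD x y : I x -> I y -> I (x + y).
Proof. by move=> hx hy; rewrite -[x]scale1r; apply: idealP. Qed.

Lemma idealZ (c : K) x : I x -> I (c *: x).
Proof. by move=> hx; rewrite -[_ *: _]addr0; apply: idealP ideal0. Qed.

Lemma idealN x : I x -> I (- x).
Proof. by move=> hx; rewrite -scaleN1r; apply: idealZ. Qed.

Definition ideal_rel (x y : L) : Prop := I (x - y).

Lemma ideal_rel_refl x : ideal_rel x x.
Proof. by rewrite /ideal_rel subrr; apply: ideal0. Qed.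

Lemma ideal_rel_sym x y : ideal_rel x y -> ideal_rel y x.
Proof. by rewrite /ideal_rel -(opprB x y); apply: idealN. Qed.

Lemma ideal_rel_trans x y z : ideal_rel x y -> ideal_rel y z -> ideal_rel x z.
Proof. by rewrite /ideal_rel => h1 h2; rewrite -(subrKA y); apply: idealD. Qed.

Definition lie_quot : Type :=
  pquot ideal_rel_refl ideal_rel_sym ideal_rel_trans.
HB.instance Definition _ := Choice.on lie_quot.

Definition lie_proj (x : L) : lie_quot := pcls _ _ _ x.
Let rep (x : lie_quot) : L := prep x.

Let repK x : lie_proj (rep x) = x. Proof. exact: prepK. Qed.

Lemma lie_projP x y : lie_proj x = lie_proj y <-> I (x - y).
Proof. exact: pclsP. Qed.

Let repP x : I (rep (lie_proj x) - x).
Proof. exact: (prepP ideal_rel_refl ideal_rel_sym ideal_rel_trans x). Qed.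

Definition quot_add x y := lie_proj (rep x + rep y).
Definition quot_opp x := lie_proj (- rep x).
Definition quot_scale (c : K) x := lie_proj (c *: rep x).
Definition quot_odd x := lie_proj (odd_part (rep x)).
Definition quot_br x y := lie_proj [rep x ,, rep y].
Definition quot_sqr x := lie_proj (squaring (rep x)).

Let qaddE x y : quot_add (lie_proj x) (lie_proj y) = lie_proj (x + y).
Proof. by apply/lie_projP; rewrite opprD addrACA; apply: idealD. Qed.

Let qoppE x : quot_opp (lie_proj x) = lie_proj (- x).
Proof. by apply/lie_projP; rewrite -opprD; apply: idealN. Qed.

Let qscaleE c x : quot_scale c (lie_proj x) = lie_proj (c *: x).
Proof. by apply/lie_projP; rewrite -scalerBr; apply: idealZ. Qed.

Let qoddE x : quot_odd (lie_proj x) = lie_proj (odd_part x).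
Proof.
by apply/lie_projP; rewrite -linearB /=; case: idealI => _ h _ _; apply: h.
Qed.

Let qbrE x y : quot_br (lie_proj x) (lie_proj y) = lie_proj [x ,, y].
Proof.
case: idealI => _ _ h _; apply/lie_projP.
have hx := repP x; have hy := repP y.
rewrite -{1}(subrK x (rep (lie_proj x))) brDl.
rewrite -addrA -linearB /=; apply: idealD; first by case: (h _ (rep (lie_proj y)) hx).
by case: (h _ x hy).
Qed.

Let qsqrE x : quot_sqr (lie_proj x) = lie_proj (squaring x).
Proof.
case: idealI => _ ho hb hs; apply/lie_projP.
have hx := repP x.
rewrite -{1}(subrK x (rep (lie_proj x))) squaringD addrAC addrK.
by apply: idealD; [apply: hs | case: (hb _ (odd_part x) (ho _ hx))].
Qed.

#[local] Opaque quot_add quot_opp quot_scale quot_odd quot_br quot_sqr.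

Let qW (P : lie_quot -> Prop) : (forall x, P (lie_proj x)) -> forall x, P x.
Proof. by move=> h x; rewrite -(repK x). Qed.

Let qaddA : associative quot_add.
Proof.
by elim/qW=> x; elim/qW=> y; elim/qW=> z; rewrite !qaddE addrA.
Qed.
Let qaddC : commutative quot_add.
Proof. by elim/qW=> x; elim/qW=> y; rewrite !qaddE addrC. Qed.
Let qadd0 : left_id (lie_proj 0) quot_add.
Proof. by elim/qW=> x; rewrite qaddE add0r. Qed.
Let qaddN : left_inverse (lie_proj 0) quot_opp quot_add.
Proof. by elim/qW=> x; rewrite qoppE qaddE addNr. Qed.

HB.instance Definition _ :=
  GRing.isZmodule.Build lie_quot qaddA qaddC qadd0 qaddN.

Let qscaleA a b x : quot_scale a (quot_scale b x) = quot_scale (a * b) x.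
Proof. by elim/qW: x => x; rewrite !qscaleE scalerA. Qed.
Let qscale1 : left_id 1 quot_scale.
Proof. by elim/qW => x; rewrite qscaleE scale1r. Qed.
Let qscaleDr : right_distributive quot_scale +%R.
Proof.
by move=> c; elim/qW => x; elim/qW => y; rewrite ![_ + _]qaddE !qscaleE
  [RHS]qaddE scalerDr.
Qed.
Let qscaleDl x : {morph quot_scale^~ x : a b / a + b}.
Proof.
by move=> a b; elim/qW: x => x; rewrite !qscaleE [RHS]qaddE scalerDl.
Qed.

HB.instance Definition _ := GRing.Zmodule_isLmodule.Build K lie_quot
  qscaleA qscale1 qscaleDr qscaleDl.

Lemma lie_proj_linear : linear lie_proj.
Proof.
by move=> c x y; rewrite -qaddE -qscaleE.
Qed.
HB.instance Definition _ :=
  GRing.isLinear.Build K L lie_quot _ lie_proj lie_proj_linear.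

Let qodd_linear : linear quot_odd.
Proof.
move=> c; elim/qW=> x; elim/qW=> y.
by rewrite -linearP !qoddE -linearP /= linearP.
Qed.
Let qodd_idem x : quot_odd (quot_odd x) = quot_odd x.
Proof. by elim/qW: x => x; rewrite !qoddE odd_part_idem. Qed.
Let qbr_linl y : linear (quot_br^~ y).
Proof.
move=> c; elim/qW=> x1; elim/qW=> x2; elim/qW: y => y.
by rewrite -linearP !qbrE -linearP /= bracket_linearl.
Qed.
Let qbr_linr x : linear (quot_br x).
Proof.
move=> c; elim/qW=> y1; elim/qW=> y2; elim/qW: x => x.
by rewrite -linearP !qbrE -linearP /= bracket_linearr.
Qed.

Let qlift a x : homog quot_odd a x -> exists2 t, parity a t & x = lie_proj t.
Proof.
elim/qW: x => x; rewrite /homog qoddE; case: a => h.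
  by exists (odd_part x); [exact: parity_odd_part | rewrite h].
exists (x - odd_part x); first exact: parity_even_part.
by rewrite linearB /= h subr0.
Qed.

Let qhomog a t : parity a t -> homog quot_odd a (lie_proj t).
Proof. by rewrite /homog qoddE => ->; case: a => //; rewrite linear0. Qed.

Let qbr_homog a b x y :
  homog quot_odd a x -> homog quot_odd b y -> homog quot_odd (a (+) b) (quot_br x y).
Proof.
move=> /qlift[{}x hx ->] /qlift[{}y hy ->]; rewrite qbrE.
by apply: qhomog; apply: bracket_homog.
Qed.
Let qsqr_odd x : quot_sqr x = quot_sqr (quot_odd x).
Proof. by elim/qW: x => x; rewrite qoddE !qsqrE squaring_odd_part. Qed.
Let qsqr_even x : homog quot_odd false (quot_sqr x).
Proof. by elim/qW: x => x; rewrite qsqrE; apply/qhomog/squaring_even. Qed.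

Let qN x : - lie_proj x = lie_proj (- x). Proof. by rewrite linearN. Qed.
Let qZ c x : c *: lie_proj x = lie_proj (c *: x).
Proof. by rewrite linearZ. Qed.
Let qD x y : lie_proj x + lie_proj y = lie_proj (x + y).
Proof. by rewrite linearD. Qed.

Let q_anticomm : 2 \notin [pchar K] -> forall a b x y,
  homog quot_odd a x -> homog quot_odd b y ->
  quot_br x y = - ((-1) ^+ (a && b) *: quot_br y x).
Proof.
move=> p2 a b _ _ /qlift[x hx ->] /qlift[y hy ->]; rewrite !(qbrE, qsqrE) ?qZ ?qN ?qD.
by rewrite (super_anticomm p2 _ _ _ _ hx hy).
Qed.
Let q_jacobi : 2 \notin [pchar K] -> forall a b x y z,
  homog quot_odd a x -> homog quot_odd b y ->
  quot_br x (quot_br y z) = quot_br (quot_br x y) z + (-1) ^+ (a && b) *: quot_br y (quot_br x z).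
Proof.
move=> p2 a b _ _ z /qlift[x hx ->] /qlift[y hy ->]; elim/qW: z => z.
by rewrite !(qbrE, qsqrE) ?qZ ?qN ?qD (super_jacobi p2 _ _ _ _ z hx hy).
Qed.
Let q_cube : 3 \in [pchar K] -> forall x, homog quot_odd true x ->
  quot_br x (quot_br x x) = 0.
Proof. by move=> p3 _ /qlift[x hx ->]; rewrite !(qbrE, qsqrE) ?qZ ?qN ?qD super_cube // linear0. Qed.
Let q_half : 2 \notin [pchar K] -> forall x, homog quot_odd true x ->
  quot_sqr x = 2^-1 *: quot_br x x.
Proof. by move=> p2 _ /qlift[x hx ->]; rewrite !(qbrE, qsqrE) ?qZ ?qN ?qD squaring_half. Qed.
Let q_alt : 2 \in [pchar K] -> forall x, homog quot_odd false x -> quot_br x x = 0.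
Proof.
by move=> p2 _ /qlift[x hx ->]; rewrite !(qbrE, qsqrE) ?qZ ?qN ?qD even_alternating // linear0.
Qed.
Let q_ejac : 2 \in [pchar K] -> forall x y z,
  homog quot_odd false x -> homog quot_odd false y -> homog quot_odd false z ->
  quot_br x (quot_br y z) = quot_br (quot_br x y) z + quot_br y (quot_br x z).
Proof.
move=> p2 _ _ _ /qlift[x hx ->] /qlift[y hy ->] /qlift[z hz ->].
by rewrite !(qbrE, qsqrE) ?qZ ?qN ?qD even_jacobi.
Qed.
Let q_mod : 2 \in [pchar K] -> forall x y v,
  homog quot_odd false x -> homog quot_odd false y -> homog quot_odd true v ->
  quot_br (quot_br x y) v = quot_br x (quot_br y v) - quot_br y (quot_br x v).
Proof.
move=> p2 _ _ _ /qlift[x hx ->] /qlift[y hy ->] /qlift[z hz ->].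
by rewrite !(qbrE, qsqrE) ?qZ ?qN ?qD odd_module.
Qed.
Let q_mixed : 2 \in [pchar K] -> forall x v,
  homog quot_odd false x -> homog quot_odd true v -> quot_br v x = - quot_br x v.
Proof.
move=> p2 _ _ /qlift[x hx ->] /qlift[y hy ->].
by rewrite !(qbrE, qsqrE) ?qZ ?qN ?qD mixed_anticomm.
Qed.
Let q_sqrZ : 2 \in [pchar K] -> forall c x, homog quot_odd true x ->
  quot_sqr (c *: x) = c ^+ 2 *: quot_sqr x.
Proof.
by move=> p2 c _ /qlift[x hx ->]; rewrite qZ !qsqrE qZ squaring_scale.
Qed.
Let q_polar : 2 \in [pchar K] -> forall x y,
  homog quot_odd true x -> homog quot_odd true y ->
  quot_br x y = quot_sqr (x + y) - quot_sqr x - quot_sqr y.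
Proof.
move=> p2 _ _ /qlift[x hx ->] /qlift[y hy ->].
rewrite (qD x y) qbrE !qsqrE (qN (squaring x)) (qN (squaring y)).
by rewrite (qD (squaring (x + y))) (qD (_ - _)) -(squaring_polar p2 _ _ hx hy).
Qed.
Let q_sqrbr : 2 \in [pchar K] -> forall x y, homog quot_odd true x ->
  quot_br (quot_sqr x) y = quot_br x (quot_br x y).
Proof.
move=> p2 _ y /qlift[x hx ->]; elim/qW: y => y.
by rewrite !(qbrE, qsqrE) ?qZ ?qN ?qD squaring_bracket.
Qed.

HB.instance Definition _ := Lmodule_isLieSuper.Build K lie_quot
  qodd_linear qodd_idem qbr_linl qbr_linr qbr_homog qsqr_odd qsqr_even
  q_anticomm q_jacobi q_cube q_half q_alt q_ejac q_mod q_mixed q_sqrZ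
  q_polar q_sqrbr.

Lemma lie_proj_odd x : lie_proj (odd_part x) = odd_part (lie_proj x).
Proof. by rewrite -qoddE. Qed.
Lemma lie_proj_bracket x y : lie_proj [x ,, y] = [lie_proj x ,, lie_proj y].
Proof. by rewrite -qbrE. Qed.
Lemma lie_proj_squaring x : lie_proj (squaring x) = squaring (lie_proj x).
Proof. by rewrite -qsqrE. Qed.

End IdealQuotient.

Record realization (K : fieldType) (n : nat) (A : 'M[K]_n) := Realization {
  torus : vectType K;
  coroot : 'I_n -> torus;
  root : 'I_n -> 'Hom(torus, K^o);
  torus_dim : \dim {:torus} = (2 * n - \rank A)%N;
  coroot_free : free [seq coroot i | i <- enum 'I_n];
  root_free : free [seq root i | i <- enum 'I_n];
  root_coroot : forall i j, root j (coroot i) = A i j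
}.

Section CartanAlgebra.
Variables (K : fieldType) (n : nat) (A : 'M[K]_n) (R : realization A).
Variable par : 'I_n -> bool.
Implicit Types (h : torus R) (i j : 'I_n).

Definition rootv j h : K := root R j h.

(* A map of the generators into L which satisfies the defining relations. *)
Record chevalley (L : lieSuperType K) := Chevalley {
  ch_h : {linear torus R -> L};
  ch_x : 'I_n -> L;
  ch_y : 'I_n -> L;
  ch_h_even : forall h, parity false (ch_h h);
  ch_x_parity : forall i, parity (par i) (ch_x i);
  ch_y_parity : forall i, parity (par i) (ch_y i);
  ch_hh : forall h h', [ch_h h ,, ch_h h'] = 0;
  ch_hx : forall h j, [ch_h h ,, ch_x j] = rootv j h *: ch_x j;
  ch_hy : forall h j, [ch_h h ,, ch_y j] = - (rootv j h *: ch_y j);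
  ch_xy : forall i j,
    [ch_x i ,, ch_y j] = if i == j then ch_h (coroot R i) else 0
}.

Inductive lie_term : Type :=
| TZero | TAdd of lie_term & lie_term | TScale of K & lie_term
| TOdd of lie_term | TBr of lie_term & lie_term | TSqr of lie_term
| TH of torus R | TX of 'I_n | TY of 'I_n.

HB.instance Definition _ := gen_eqMixin lie_term.
HB.instance Definition _ := gen_choiceMixin lie_term.

Fixpoint lie_eval (L : lieSuperType K) (c : chevalley L) (t : lie_term) : L :=
  match t with
  | TZero => 0
  | TAdd t u => lie_eval c t + lie_eval c u
  | TScale a t => a *: lie_eval c t
  | TOdd t => odd_part (lie_eval c t)
  | TBr t u => [lie_eval c t ,, lie_eval c u]
  | TSqr t => squaring (lie_eval c t)
  | TH h => ch_h c h
  | TX i => ch_x c i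
  | TY i => ch_y c i
  end.

(* The Lie superalgebra presented by the generators and relations: terms in   *)
(* the generators, identified when they agree in every Lie superalgebra in    *)
(* which the relations hold. See [tilde_universal] and [tilde_gen] below.     *)
Definition lie_term_rel (t u : lie_term) : Prop :=
  forall (L : lieSuperType K) (c : chevalley L), lie_eval c t = lie_eval c u.

Lemma lie_term_refl t : lie_term_rel t t. Proof. by []. Qed.
Lemma lie_term_sym t u : lie_term_rel t u -> lie_term_rel u t.
Proof. by move=> h L c; rewrite h. Qed.
Lemma lie_term_trans t u v :
  lie_term_rel t u -> lie_term_rel u v -> lie_term_rel t v.
Proof. by move=> h1 h2 L c; rewrite h1. Qed.

Definition tilde_alg : Type := pquot lie_term_refl lie_term_sym lie_term_trans.
HB.instance Definition _ := Choice.on tilde_alg.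

Definition tcls (t : lie_term) : tilde_alg := pcls _ _ _ t.
Definition tev (L : lieSuperType K) (c : chevalley L) (x : tilde_alg) : L :=
  lie_eval c (prep x).

Lemma tevE (L : lieSuperType K) (c : chevalley L) t : tev c (tcls t) = lie_eval c t.
Proof. exact: (prepP lie_term_refl lie_term_sym lie_term_trans t L c). Qed.

Lemma tev_inj (x y : tilde_alg) :
  (forall (L : lieSuperType K) (c : chevalley L), tev c x = tev c y) -> x = y.
Proof.
move=> h; rewrite -(prepK x) -(prepK y).
by apply/pclsP => L c; apply: h.
Qed.

Definition tzero := tcls TZero.
Definition tadd (x y : tilde_alg) := tcls (TAdd (prep x) (prep y)).
Definition topp (x : tilde_alg) := tcls (TScale (-1) (prep x)).
Definition tscale (a : K) (x : tilde_alg) := tcls (TScale a (prep x)).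
Definition todd (x : tilde_alg) := tcls (TOdd (prep x)).
Definition tbr (x y : tilde_alg) := tcls (TBr (prep x) (prep y)).
Definition tsqr (x : tilde_alg) := tcls (TSqr (prep x)).

Section Eval.
Variables (L : lieSuperType K) (c : chevalley L).
Lemma tev0 : tev c tzero = 0. Proof. exact: tevE. Qed.
Lemma tevD x y : tev c (tadd x y) = tev c x + tev c y.
Proof. exact: tevE. Qed.
Lemma tevN x : tev c (topp x) = - tev c x.
Proof. by rewrite tevE /= scaleN1r. Qed.
Lemma tevZ a x : tev c (tscale a x) = a *: tev c x. Proof. exact: tevE. Qed.
Lemma tevO x : tev c (todd x) = odd_part (tev c x). Proof. exact: tevE. Qed.
Lemma tevB x y : tev c (tbr x y) = [tev c x ,, tev c y].
Proof. exact: tevE. Qed.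
Lemma tevS x : tev c (tsqr x) = squaring (tev c x). Proof. exact: tevE. Qed.
End Eval.

Let tE := (tev0, tevD, tevN, tevZ, tevO, tevB, tevS).

Let taddA : associative tadd.
Proof. by move=> x y z; apply: tev_inj => L c; rewrite !tE addrA. Qed.
Let taddC : commutative tadd.
Proof. by move=> x y; apply: tev_inj => L c; rewrite !tE addrC. Qed.
Let tadd0 : left_id tzero tadd.
Proof. by move=> x; apply: tev_inj => L c; rewrite !tE add0r. Qed.
Let taddN : left_inverse tzero topp tadd.
Proof. by move=> x; apply: tev_inj => L c; rewrite !tE addNr. Qed.
HB.instance Definition _ :=
  GRing.isZmodule.Build tilde_alg taddA taddC tadd0 taddN.

Let tscaleA a b x : tscale a (tscale b x) = tscale (a * b) x.
Proof. by apply: tev_inj => L c; rewrite !tE scalerA. Qed.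
Let tscale1 : left_id 1 tscale.
Proof. by move=> x; apply: tev_inj => L c; rewrite !tE scale1r. Qed.
Let tscaleDr : right_distributive tscale +%R.
Proof. by move=> a x y; apply: tev_inj => L c; rewrite !tE scalerDr. Qed.
Let tscaleDl x : {morph tscale^~ x : a b / a + b}.
Proof. by move=> a b; apply: tev_inj => L c; rewrite !tE scalerDl. Qed.
HB.instance Definition _ := GRing.Zmodule_isLmodule.Build K tilde_alg
  tscaleA tscale1 tscaleDr tscaleDl.

Lemma tev_linear L (c : chevalley L) : linear (tev c).
Proof. by move=> a x y; rewrite -tevZ -tevD. Qed.
HB.instance Definition _ L (c : chevalley L) :=
  GRing.isLinear.Build K tilde_alg L _ (tev c) (tev_linear c).

Let tlin L (c : chevalley L) : (tev c 0 = 0) *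
  (forall x y, tev c (x + y) = tev c x + tev c y) *
  (forall x, tev c (- x) = - tev c x) *
  (forall a x, tev c (a *: x) = a *: tev c x).
Proof.
by do !split=> *; rewrite ?linear0 ?linearD ?linearN ?linearZ.
Qed.

Let tev_homog a x L (c : chevalley L) :
  homog todd a x -> parity a (tev c x).
Proof.
move=> h; rewrite /homog -tevO h; case: a {h} => //.
by rewrite tlin.
Qed.

Let todd_linear : linear todd.
Proof. by move=> a x y; apply: tev_inj => L c; rewrite !(tE, tlin) linearP. Qed.
Let todd_idem x : todd (todd x) = todd x.
Proof. by apply: tev_inj => L c; rewrite !tE odd_part_idem. Qed.
Let tbr_linl y : linear (tbr^~ y).
Proof.
move=> a x x'; apply: tev_inj => L c.
by rewrite !(tE, tlin) bracket_linearl.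
Qed.
Let tbr_linr x : linear (tbr x).
Proof.
move=> a y y'; apply: tev_inj => L c.
by rewrite !(tE, tlin) bracket_linearr.
Qed.
Let tbr_homog a b x y :
  homog todd a x -> homog todd b y -> homog todd (a (+) b) (tbr x y).
Proof.
move=> hx hy; apply: tev_inj => L c; rewrite !tE.
rewrite (bracket_homog _ _ _ _ (tev_homog c hx) (tev_homog c hy)).
by case: (a (+) b); rewrite ?tE ?tlin.
Qed.
Let tsqr_odd x : tsqr x = tsqr (todd x).
Proof. by apply: tev_inj => L c; rewrite !tE squaring_odd_part. Qed.
Let tsqr_even x : homog todd false (tsqr x).
Proof. by apply: tev_inj => L c; rewrite !tE ?tlin squaring_even. Qed.
Let t_anticomm : 2 \notin [pchar K] -> forall a b x y,
  homog todd a x -> homog todd b y ->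
  tbr x y = - ((-1) ^+ (a && b) *: tbr y x).
Proof.
move=> p2 a b x y hx hy; apply: tev_inj => L c; rewrite !(tE, tlin).
exact: (super_anticomm p2 _ _ _ _ (tev_homog c hx) (tev_homog c hy)).
Qed.
Let t_jacobi : 2 \notin [pchar K] -> forall a b x y z,
  homog todd a x -> homog todd b y ->
  tbr x (tbr y z) = tbr (tbr x y) z + (-1) ^+ (a && b) *: tbr y (tbr x z).
Proof.
move=> p2 a b x y z hx hy; apply: tev_inj => L c; rewrite !(tE, tlin).
exact: (super_jacobi p2 _ _ _ _ _ (tev_homog c hx) (tev_homog c hy)).
Qed.
Let t_cube : 3 \in [pchar K] -> forall x, homog todd true x ->
  tbr x (tbr x x) = 0.
Proof.
move=> p3 x hx; apply: tev_inj => L c; rewrite !(tE, tlin).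
exact: (super_cube p3 _ (tev_homog c hx)).
Qed.
Let t_half : 2 \notin [pchar K] -> forall x, homog todd true x ->
  tsqr x = 2^-1 *: tbr x x.
Proof.
move=> p2 x hx; apply: tev_inj => L c; rewrite !(tE, tlin).
exact: (squaring_half p2 _ (tev_homog c hx)).
Qed.
Let t_alt : 2 \in [pchar K] -> forall x, homog todd false x -> tbr x x = 0.
Proof.
move=> p2 x hx; apply: tev_inj => L c; rewrite !(tE, tlin).
exact: (even_alternating p2 _ (tev_homog c hx)).
Qed.
Let t_ejac : 2 \in [pchar K] -> forall x y z,
  homog todd false x -> homog todd false y -> homog todd false z ->
  tbr x (tbr y z) = tbr (tbr x y) z + tbr y (tbr x z).
Proof.
move=> p2 x y z hx hy hz; apply: tev_inj => L c; rewrite !(tE, tlin).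
exact: (even_jacobi p2 _ _ _ (tev_homog c hx) (tev_homog c hy)
          (tev_homog c hz)).
Qed.
Let t_mod : 2 \in [pchar K] -> forall x y v,
  homog todd false x -> homog todd false y -> homog todd true v ->
  tbr (tbr x y) v = tbr x (tbr y v) - tbr y (tbr x v).
Proof.
move=> p2 x y z hx hy hz; apply: tev_inj => L c; rewrite !(tE, tlin).
exact: (odd_module p2 _ _ _ (tev_homog c hx) (tev_homog c hy)
          (tev_homog c hz)).
Qed.
Let t_mixed : 2 \in [pchar K] -> forall x v,
  homog todd false x -> homog todd true v -> tbr v x = - tbr x v.
Proof.
move=> p2 x y hx hy; apply: tev_inj => L c; rewrite !(tE, tlin).
exact: (mixed_anticomm p2 _ _ (tev_homog c hx) (tev_homog c hy)).
Qed.
Let t_sqrZ : 2 \in [pchar K] -> forall c x, homog todd true x ->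
  tsqr (c *: x) = c ^+ 2 *: tsqr x.
Proof.
move=> p2 a x hx; apply: tev_inj => L c; rewrite !(tE, tlin).
exact: (squaring_scale p2 _ _ (tev_homog c hx)).
Qed.
Let t_polar : 2 \in [pchar K] -> forall x y,
  homog todd true x -> homog todd true y ->
  tbr x y = tsqr (x + y) - tsqr x - tsqr y.
Proof.
move=> p2 x y hx hy; apply: tev_inj => L c; rewrite !(tE, tlin).
exact: (squaring_polar p2 _ _ (tev_homog c hx) (tev_homog c hy)).
Qed.
Let t_sqrbr : 2 \in [pchar K] -> forall x y, homog todd true x ->
  tbr (tsqr x) y = tbr x (tbr x y).
Proof.
move=> p2 x y hx; apply: tev_inj => L c; rewrite !(tE, tlin).
exact: (squaring_bracket p2 _ _ (tev_homog c hx)).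
Qed.

HB.instance Definition _ := Lmodule_isLieSuper.Build K tilde_alg
  todd_linear todd_idem tbr_linl tbr_linr tbr_homog tsqr_odd tsqr_even
  t_anticomm t_jacobi t_cube t_half t_alt t_ejac t_mod t_mixed t_sqrZ
  t_polar t_sqrbr.

Let tevOE x L (c : chevalley L) : tev c (odd_part x) = odd_part (tev c x).
Proof. exact: tevO. Qed.
Let tevBE x y L (c : chevalley L) : tev c [x ,, y] = [tev c x ,, tev c y].
Proof. exact: tevB. Qed.

Definition tilde_h h : tilde_alg := tcls (TH h).
Definition tilde_x i : tilde_alg := tcls (TX i).
Definition tilde_y i : tilde_alg := tcls (TY i).

Lemma tilde_h_linear : linear tilde_h.
Proof.
move=> a x y; apply: tev_inj => L c; rewrite !tlin !tevE /=.
exact: linearP.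
Qed.
HB.instance Definition _ :=
  GRing.isLinear.Build K (torus R) tilde_alg _ tilde_h tilde_h_linear.

Lemma tilde_h_even h : parity false (tilde_h h).
Proof. by apply: tev_inj => L c; rewrite tevOE tlin tevE /= ch_h_even. Qed.
Lemma tilde_x_parity i : parity (par i) (tilde_x i).
Proof.
apply: tev_inj => L c; rewrite tevOE tevE /= ch_x_parity.
by case: (par i); rewrite ?tevE ?tlin.
Qed.
Lemma tilde_y_parity i : parity (par i) (tilde_y i).
Proof.
apply: tev_inj => L c; rewrite tevOE tevE /= ch_y_parity.
by case: (par i); rewrite ?tevE ?tlin.
Qed.
Lemma tilde_hh h h' : [tilde_h h ,, tilde_h h'] = 0.
Proof. by apply: tev_inj => L c; rewrite tevBE tlin !tevE /= ch_hh. Qed.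
Lemma tilde_hx h j : [tilde_h h ,, tilde_x j] = rootv j h *: tilde_x j.
Proof. by apply: tev_inj => L c; rewrite tevBE tlin !tevE /= ch_hx. Qed.
Lemma tilde_hy h j : [tilde_h h ,, tilde_y j] = - (rootv j h *: tilde_y j).
Proof. by apply: tev_inj => L c; rewrite tevBE !tlin !tevE /= ch_hy. Qed.
Lemma tilde_xy i j :
  [tilde_x i ,, tilde_y j] = if i == j then tilde_h (coroot R i) else 0.
Proof.
apply: tev_inj => L c; rewrite tevBE !tevE /= ch_xy.
by case: (i == j); rewrite ?tevE ?tlin.
Qed.

Definition tilde_gen : chevalley tilde_alg :=
  Chevalley tilde_h_even tilde_x_parity tilde_y_parity
    tilde_hh tilde_hx tilde_hy tilde_xy.

Lemma tilde_universal (L : lieSuperType K) (c : chevalley L) :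
  exists f : {linear tilde_alg -> L},
    [/\ forall x, f (odd_part x) = odd_part (f x),
        forall x y, f [x ,, y] = [f x ,, f y],
        forall x, f (squaring x) = squaring (f x) &
        [/\ forall h, f (tilde_h h) = ch_h c h,
            forall i, f (tilde_x i) = ch_x c i &
            forall i, f (tilde_y i) = ch_y c i]].
Proof.
exists (tev c); split; [exact: tevO | exact: tevB | exact: tevS |].
by split=> h; rewrite /= tevE.
Qed.

Lemma tilde_generated (H : set tilde_alg) : sub_superalgebra H ->
  (forall h, H (tilde_h h)) -> (forall i, H (tilde_x i)) ->
  (forall i, H (tilde_y i)) -> forall x, H x.
Proof.
case=> -[H0 HP] HO HB HS Hh Hx Hy x.
rewrite -(prepK x : tcls (prep x) = x); elim: (prep x) => //.
- move=> t ht u hu.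
  have -> : tcls (TAdd t u) = 1 *: tcls t + tcls u.
    by apply: tev_inj => L c; rewrite !tlin !tevE scale1r.
  exact: HP.
- move=> a t ht.
  have -> : tcls (TScale a t) = a *: tcls t + 0.
    by apply: tev_inj => L c; rewrite !tlin !tevE addr0.
  exact: HP.
- move=> t ht; have -> : tcls (TOdd t) = odd_part (tcls t).
    by apply: tev_inj => L c; rewrite tevOE !tevE.
  exact: HO.
- move=> t ht u hu; have -> : tcls (TBr t u) = [tcls t ,, tcls u].
    by apply: tev_inj => L c; rewrite tevBE !tevE.
  exact: HB.
- move=> t ht; have -> : tcls (TSqr t) = squaring (tcls t).
    by apply: tev_inj => L c; rewrite [RHS]tevS !tevE.
  exact: HS.
Qed.

(* The Z^n-grading: [tilde_degree d] is the homogeneous component of degree d.*)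
Inductive tilde_degree : 'rV[int]_n -> set tilde_alg :=
| degree0 d : tilde_degree d 0
| degreeP d (a : K) u v : tilde_degree d u -> tilde_degree d v ->
    tilde_degree d (a *: u + v)
| degree_bracket d e u v : tilde_degree d u -> tilde_degree e v ->
    tilde_degree (d + e) [u ,, v]
| degree_squaring d u : tilde_degree d u -> parity true u ->
    tilde_degree (d *+ 2) (squaring u)
| degree_h h : tilde_degree 0 (tilde_h h)
| degree_x i : tilde_degree (delta_mx 0 i) (tilde_x i)
| degree_y i : tilde_degree (- delta_mx 0 i) (tilde_y i).

Definition graded_ideal (I : set tilde_alg) : Prop :=
  ideal I /\ forall u, I u -> exists s : seq ('rV[int]_n * tilde_alg),
    (forall w, w \in s -> tilde_degree w.1 w.2 /\ I w.2) /\
    u = \sum_(w <- s) w.2.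

Definition torus_trivial (I : set tilde_alg) : Prop :=
  forall h, I (tilde_h h) -> tilde_h h = 0.

(* The largest graded ideal which meets the torus trivially, as the sum of    *)
(* all such ideals.                                                           *)
Definition max_ideal : set tilde_alg :=
  lin_span (fun u => exists I, [/\ graded_ideal I, torus_trivial I & I u]).

Lemma max_idealP : ideal max_ideal.
Proof.
have D u v : max_ideal u -> max_ideal v -> max_ideal (u + v).
  move=> hu hv; elim: hu => [|a x y hx _ ih]; first by rewrite add0r.
  by rewrite -addrA; apply: lin_spanP.
have Z (a : K) u : max_ideal u -> max_ideal (a *: u).
  elim=> [|b x y hx _ ih]; first by rewrite scaler0; apply: lin_span0.
  by rewrite scalerDr scalerA; apply: lin_spanP.
have G I u : graded_ideal I -> torus_trivial I -> I u -> max_ideal u.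
  move=> h1 h2 hu; rewrite -[u]addr0 -[u]scale1r.
  by apply: lin_spanP; [exists I | apply: lin_span0].
have O u : max_ideal u -> max_ideal (odd_part u).
  elim=> [|b x y [I [h1 h2 hx]] _ ih]; first by rewrite linear0; apply: lin_span0.
  rewrite linearP; apply: D ih; apply: Z; apply: (G I) => //.
  by case: h1 => -[_ h _ _] _; apply: h.
have B u v : max_ideal u -> max_ideal [u ,, v] /\ max_ideal [v ,, u].
  elim=> [|b x y [I [h1 h2 hx]] _ [ih1 ih2]].
    by rewrite br0l linear0; split; apply: lin_span0.
  have [i1 i2] : I [x ,, v] /\ I [v ,, x].
    by case: h1 => -[_ _ h _] _; apply: h.
  rewrite brDl brZl linearP.
  by split; apply: D => //; apply: Z; apply: (G I).
split=> //; first by split=> [|a u v hu hv]; [apply: lin_span0 | apply/D/hv/Z].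
move=> u; elim=> [|b x y [I [h1 h2 hx]] hy ih].
  by rewrite squaring0; apply: lin_span0.
rewrite squaringD; apply: (D); last first.
  by case: (B (odd_part y) (odd_part (b *: x)) (O _ hy)).
apply: D ih; apply: (G I) => //.
by case: h1 => hI _; case: (hI) => _ _ _; apply; apply: idealZ.
Qed.

Definition cartan_alg : lieSuperType K := lie_quot max_idealP.

Definition cartan_h : {linear torus R -> cartan_alg} :=
  lie_proj max_idealP \o tilde_h.
Definition cartan_x i : cartan_alg := lie_proj max_idealP (tilde_x i).
Definition cartan_y i : cartan_alg := lie_proj max_idealP (tilde_y i).

Definition grading_element h : Prop := forall i,
  (exists c : K, [cartan_h h ,, cartan_x i] = c *: cartan_x i) /\
  (exists c : K, [cartan_h h ,, cartan_y i] = c *: cartan_y i).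

End CartanAlgebra.

(* Main.v *)
(* The elements x_i, y_i and the coroots lie in g', so counting dimensions in  *)
(* the torus gives g = g' + K D. Since M kills g' and has central values, all  *)
(* the derivation identities reduce to 0 = 0. If M were ad_x, then             *)
(* [D, x] = - z would be a nonzero element of ker (ad D) \cap im (ad D); but   *)
(* ad D is diagonalizable, because its eigenvectors span a subalgebra which    *)
(* contains the generators.                                                    *)
Require Import Defs.
From HB Require Import structures.
From mathcomp Require Import all_boot all_order all_algebra.
From mathcomp Require Import boolp classical_sets.

Set Implicit Arguments.
Unset Strict Implicit.
Unset Printing Implicit Defensive.

Import GRing.Theory.
Local Open Scope ring_scope.
Local Open Scope lie_scope.

(** Write g' for the derived algebra. By [cartan_derived_line], g = g' + K D, and the sum is direct
    because D lies outside g'; so M is the coordinate along D times z. Brackets and squares lie in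
    g', where M vanishes, and the values of M are central, so M is a derivation
    ([derived_line_map_derivation]). It is not inner: eigenvectors of ad D span g
    ([cartan_h_diagonalizable]), hence the kernel and image of ad D meet only in 0
    ([ad_diagonalizable_ker_im]), whereas M = ad_x would put [D, x] = -z in both. The technical
    input is that, for even d and in every characteristic, ad d respects brackets and squares
    ([even_jacobiP], [sub_superalgebra_eigen]). *)

Lemma linear_bundle (K : fieldType) (V W : lmodType K) (f : V -> W) :
  linear f -> exists F : {linear V -> W}, F =1 f.
Proof.
move=> fL; pose F : {linear V -> W} :=
  HB.pack f (GRing.isLinear.Build K V W _ f fL).
by exists F.
Qed.

(** * Linear spans and the derived algebra as an ideal *)

Section LinSpan.
Variables (K : fieldType) (L : lieSuperType K).
Implicit Types (S : set L) (x y d : L).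

Lemma lin_span_incl S x : S x -> lin_span S x.
Proof.
by move=> Sx; rewrite -[x]addr0 -[x]scale1r; apply: lin_spanP (lin_span0 _).
Qed.

Lemma lin_spanD S x y : lin_span S x -> lin_span S y -> lin_span S (x + y).
Proof.
move=> hx hy; elim: hx => [|c u v Su _ ih]; first by rewrite add0r.
by rewrite -addrA; apply: lin_spanP.
Qed.

Lemma lin_spanZ S (c : K) x : lin_span S x -> lin_span S (c *: x).
Proof.
elim=> [|b u v Su _ ih]; first by rewrite scaler0; apply: lin_span0.
by rewrite scalerDr scalerA; apply: lin_spanP.
Qed.

Lemma lin_spanN S x : lin_span S x -> lin_span S (- x).
Proof. by rewrite -scaleN1r; apply: lin_spanZ. Qed.

Lemma subspace_lin_span S : subspace (lin_span S).
Proof.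
split; first exact: lin_span0.
by move=> c x y hx hy; apply: lin_spanD hy; apply: lin_spanZ.
Qed.

Lemma pchar2N (p2 : 2 \in [pchar K]) x : - x = x.
Proof.
apply/eqP; rewrite eq_sym -subr_eq0 opprK -mulr2n -scaler_nat.
by rewrite (pcharf0 p2) scale0r.
Qed.

Lemma derived_bracket x y : derived_alg [x ,, y].
Proof. by apply: lin_span_incl; left; exists x, y. Qed.

(** Squares are listed among the generators of [derived_alg] only in characteristic 2; otherwise a
    square is half a bracket. *)
Lemma derived_squaring x : derived_alg (squaring x).
Proof.
rewrite squaring_odd_part; have hx := parity_odd_part x.
have [p2|p2] := boolP (2 \in [pchar K]).
  by apply: lin_span_incl; right; split=> //; exists (odd_part x).
by rewrite squaring_half //; apply/lin_spanZ/derived_bracket.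
Qed.

Lemma odd_part_bracket x y :
  odd_part [x ,, y] =
    [x - odd_part x ,, odd_part y] + [odd_part x ,, y - odd_part y].
Proof.
have [x0 x1] := (parity_even_part x, parity_odd_part x).
have [y0 y1] := (parity_even_part y, parity_odd_part y).
rewrite -{1}(subrK (odd_part x) x) -{1}(subrK (odd_part y) y).
set u0 := x - _ in x0 *; set u1 := odd_part x in x1 *.
set v0 := y - _ in y0 *; set v1 := odd_part y in y1 *.
clearbody u0 u1 v0 v1.
rewrite brDl !brD !linearD /=.
rewrite (bracket_homog _ _ _ _ x0 y0) (bracket_homog _ _ _ _ x0 y1).
rewrite (bracket_homog _ _ _ _ x1 y0) (bracket_homog _ _ _ _ x1 y1) /=.
by rewrite add0r addr0.
Qed.

Lemma derived_odd_part x : derived_alg x -> derived_alg (odd_part x).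
Proof.
elim=> [|c u v hu _ ih]; first by rewrite linear0; apply: lin_span0.
rewrite linearP /=; apply: lin_spanD ih; apply: lin_spanZ.
case: hu => [[a [b ->]]|[_ [a _ ->]]].
  by rewrite odd_part_bracket; apply: lin_spanD; apply: derived_bracket.
by rewrite squaring_even; apply: lin_span0.
Qed.

Lemma ideal_derived : ideal (@derived_alg K L).
Proof.
split.
- exact: subspace_lin_span.
- exact: derived_odd_part.
- by move=> x y _; split; apply: derived_bracket.
- by move=> x _; apply: derived_squaring.
Qed.

(** * Brackets with an even element, uniformly in the characteristic *)

Lemma even_bracketC d x : parity false d -> [d ,, x] = - [x ,, d].
Proof.
move=> d0; have [x0 x1] := (parity_even_part x, parity_odd_part x).
have [p2|p2] := boolP (2 \in [pchar K]); last first.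
  rewrite -(subrK (odd_part x) x) brDl brD opprD.
  rewrite (super_anticomm p2 _ _ _ _ d0 x0) (super_anticomm p2 _ _ _ _ d0 x1).
  by rewrite /= !expr0 !scale1r.
rewrite -(subrK (odd_part x) x) brDl brD opprD.
rewrite (mixed_anticomm p2 _ _ d0 x1) opprK; congr (_ + _).
set u := x - _ in x0 *; clearbody u.
(* In characteristic 2 the even-even case comes from polarising [even_alternating] at [d + u]. *)
have du0 : parity false (d + u) by rewrite /homog linearD /= d0 x0 addr0.
have := even_alternating p2 _ du0.
rewrite brDl !brD (even_alternating p2 _ d0) (even_alternating p2 _ x0).
by rewrite add0r addr0 => /eqP; rewrite addr_eq0 => /eqP.
Qed.

Lemma even_bracket_self d : parity false d -> [d ,, d] = 0.
Proof.
move=> d0; have [p2|p2] := boolP (2 \in [pchar K]).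
  exact: even_alternating.
have /eqP := even_bracketC d d0.
rewrite -addr_eq0 -mulr2n -scaler_nat scaler_eq0 => /orP[/eqP e|/eqP //].
by case/negP: p2; rewrite inE /= e eqxx.
Qed.

Lemma even_bracket_squaring (p2 : 2 \in [pchar K]) d x :
  parity false d -> parity true x -> [d ,, squaring x] = [x ,, [d ,, x]].
Proof.
move=> d0 x1; rewrite even_bracketC // squaring_bracket //.
by rewrite (even_bracketC x d0) (linearN (bracket x)).
Qed.

Lemma odd_bracketC (p2 : 2 \in [pchar K]) x y :
  parity true x -> parity true y -> [x ,, y] = [y ,, x].
Proof.
by move=> hx hy; rewrite !squaring_polar // [y + x]addrC addrAC.
Qed.

(** In characteristic 2 the identity is scattered over the axioms by parity: even-even is
    [even_jacobi], even-odd is [odd_module], odd-even follows by antisymmetry, and odd-odd by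
    polarising the squaring. *)
Lemma even_jacobiP d x y : parity false d ->
  [d ,, [x ,, y]] = [[d ,, x] ,, y] + [x ,, [d ,, y]].
Proof.
move=> d0; have [p2|p2] := boolP (2 \in [pchar K]); last first.
  have [x0 x1] := (parity_even_part x, parity_odd_part x).
  rewrite -(subrK (odd_part x) x).
  set u0 := x - _ in x0 *; set u1 := odd_part x in x1 *; clearbody u0 u1.
  rewrite !brDl !brD.
  rewrite (super_jacobi p2 _ _ _ _ y d0 x0) (super_jacobi p2 _ _ _ _ y d0 x1).
  by rewrite /= !expr0 !scale1r brDl addrACA.
have [x0 x1] := (parity_even_part x, parity_odd_part x).
have [y0 y1] := (parity_even_part y, parity_odd_part y).
have dJ01 u v : parity false u -> parity true v ->
    [d ,, [u ,, v]] = [[d ,, u] ,, v] + [u ,, [d ,, v]].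
  by move=> u0 v1; rewrite (odd_module p2 _ _ _ d0 u0 v1) subrK.
have dJ10 u v : parity true u -> parity false v ->
    [d ,, [u ,, v]] = [[d ,, u] ,, v] + [u ,, [d ,, v]].
  move=> u1 v0; have du1 := bracket_homog _ _ _ _ d0 u1.
  have dv0 := bracket_homog _ _ _ _ d0 v0.
  rewrite (mixed_anticomm p2 _ _ v0 u1) (mixed_anticomm p2 _ _ v0 du1).
  rewrite (mixed_anticomm p2 _ _ dv0 u1) (linearN (bracket d)) /= dJ01 //.
  by rewrite opprD addrC.
have dJ11 u v : parity true u -> parity true v ->
    [d ,, [u ,, v]] = [[d ,, u] ,, v] + [u ,, [d ,, v]].
  move=> u1 v1; have du1 := bracket_homog _ _ _ _ d0 u1.
  have uv1 : parity true (u + v) by rewrite /homog linearD /= u1 v1.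
  rewrite (squaring_polar p2 _ _ u1 v1) !(linearB (bracket d)) /=.
  rewrite !even_bracket_squaring // !brD !brDl.
  rewrite (odd_bracketC p2 v1 du1) addrA [LHS]addrAC addrK [LHS]addrAC.
  by rewrite [_ + [[d ,, u] ,, v]]addrC addrK.
rewrite -(subrK (odd_part x) x) -(subrK (odd_part y) y).
set u0 := x - _ in x0 *; set u1 := odd_part x in x1 *.
set v0 := y - _ in y0 *; set v1 := odd_part y in y1 *.
clearbody u0 u1 v0 v1.
rewrite !(brDl, brD) (even_jacobi p2 _ _ _ d0 x0 y0) dJ01 // dJ10 // dJ11 //.
(* On the left, odd positions hold the terms [[d, u], v] and even positions the terms [u,
   [d, v]]. *)
by rewrite [LHS](AC ((2*2)*(2*2)) (1*5*(3*7)*(2*4*(6*8)))).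
Qed.

Lemma even_odd_part_bracket d x : parity false d ->
  odd_part [d ,, x] = [d ,, odd_part x].
Proof.
by move=> d0; rewrite odd_part_bracket d0 subr0 br0l addr0.
Qed.

(** * Eigenvectors of ad d *)

Definition ad_eigen d x : Prop := exists c : K, [d ,, x] = c *: x.

Definition ad_diagonalizable d : Prop := forall x, lin_span (ad_eigen d) x.

(** As ad d is an even derivation, it commutes with [odd_part], and eigenvalues add under brackets.
    The squaring is not additive, but [squaringD] reduces it to squares of eigenvectors and brackets
    of odd parts. *)
Lemma sub_superalgebra_eigen d : parity false d ->
  sub_superalgebra (lin_span (ad_eigen d)).
Proof.
move=> d0.
have eO x : ad_eigen d x -> ad_eigen d (odd_part x).
  by case=> c e; exists c; rewrite -even_odd_part_bracket // e linearZ.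
have sO x : lin_span (ad_eigen d) x -> lin_span (ad_eigen d) (odd_part x).
  elim=> [|c u v eu _ ih]; first by rewrite linear0; apply: lin_span0.
  by rewrite linearP; apply: lin_spanP => //; apply: eO.
have eB x y : ad_eigen d x -> ad_eigen d y -> ad_eigen d [x ,, y].
  case=> [a ea] [b eb]; exists (a + b).
  by rewrite even_jacobiP // ea eb brZ brZl scalerDl.
have sB x y : lin_span (ad_eigen d) x -> lin_span (ad_eigen d) y ->
    lin_span (ad_eigen d) [x ,, y].
  move=> hx hy; elim: hx => [|c u v eu _ ih].
    by rewrite br0l; apply: lin_span0.
  rewrite brDl brZl; apply: lin_spanD ih; apply: lin_spanZ.
  elim: hy => [|b s t es _ ih]; first by rewrite linear0; apply: lin_span0.
  by rewrite linearP; apply: lin_spanP => //; apply: eB.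
split=> //; first exact: subspace_lin_span.
move=> x; elim=> [|c u v eu hv ih].
  by rewrite squaring0; apply: lin_span0.
rewrite squaringD; apply: lin_spanD; last first.
  apply: sB; last exact: sO.
  by apply: sO; apply: lin_spanZ; apply: lin_span_incl.
apply: lin_spanD ih; apply: lin_span_incl.
rewrite squaring_odd_part linearZ /=; have w1 := parity_odd_part u.
have [a ea] := eO _ eu.
have [p2|p2] := boolP (2 \in [pchar K]); last first.
  rewrite squaring_half //; last by rewrite /homog linearZ /= w1.
  exists (a + a); rewrite !brZ even_jacobiP // brZ ea !(brZ, brZl).
  rewrite (scalerA a c) (mulrC a c) -(scalerA c a) -scalerDr -scalerDl !scalerA.
  by rewrite -!mulrA [in RHS]mulrC !mulrA.
(* In characteristic 2 the doubled eigenvalue [a + a] is 0. *)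
exists 0; rewrite scale0r squaring_scale // linearZ /=.
rewrite even_bracket_squaring // ea brZ.
have -> : [odd_part u ,, odd_part u] = 0.
  rewrite squaring_polar // -{2}(pchar2N p2 (odd_part u)) subrr squaring0.
  by rewrite sub0r {1}(pchar2N p2) subrr.
by rewrite !scaler0.
Qed.

(** A polynomial in ad d with nonzero roots kills [d, x], since x is a finite sum of eigenvectors;
    on the kernel of ad d, which contains [d, x], it is injective. *)
Lemma ad_diagonalizable_ker_im d x : ad_diagonalizable d ->
  [d ,, [d ,, x]] = 0 -> [d ,, x] = 0.
Proof.
move=> diag ddx; pose step (c : K) (w : L) := [d ,, w] - c *: w.
(* [P s] is the product of the operators ad d - c for c in [s]. *)
pose P (s : seq K) (w : L) := foldr step w s.
have stepC c s w : P s (step c w) = step c (P s w).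
  elim: s => //= b s ->; rewrite /step !(linearB (bracket d)) /= !brZ.
  by rewrite !scalerBr !opprB !scalerA mulrC [LHS](AC (2*2) (1*4*(3*2))).
have P0 s : P s 0 = 0.
  by elim: s => //= c s ->; rewrite /step linear0 scaler0 subrr.
have PD s a u v : P s (a *: u + v) = a *: P s u + P s v.
  elim: s => //= c s ->; rewrite /step linearP /= scalerDr scalerBr opprD.
  by rewrite !scalerA mulrC addrACA.
have PC s t w : P s (P t w) = P t (P s w).
  by elim: t => //= c t ih; rewrite stepC ih.
(* s lists the nonzero eigenvalues occurring in x, and P s acts on ker (ad d)  *)
(* as a nonzero scalar.                                                        *)
have [s s0 Ps] : exists2 s : seq K, 0 \notin s & P s [d ,, x] = 0.
  elim: (diag x) => [|a u v [c eu] _ [s s0 Ps]].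
    by exists [::]; rewrite ?P0 //= linear0.
  have [c0|c0] := eqVneq c 0.
    by exists s; rewrite // linearP /= eu c0 scale0r scaler0 add0r.
  (* The new factor ad d - c kills the contribution of [u] and commutes past [P s], which already
     kills that of [v]. *)
  exists (c :: s); first by rewrite inE negb_or eq_sym c0.
  rewrite linearP /= -stepC /step eu linearP /= linearZ /= eu.
  rewrite scalerDr !scalerA [c * a]mulrC opprD addrACA subrr add0r.
  by rewrite -/(step c [d ,, v]) stepC Ps /step linear0 scaler0 subrr.
elim: s s0 Ps => //= c s ih; rewrite inE negb_or eq_sym => /andP[c0 s0].
rewrite -stepC /step ddx sub0r -scaleNr -[_ *: _]addr0 PD P0 addr0 => /eqP.
by rewrite scaler_eq0 oppr_eq0 (negbTE c0) /= => /eqP; apply: ih.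
Qed.

(** * The map M when the derived algebra and one even element span everything *)

Section OuterDerivation.
Variables d z : L.
Hypotheses (d_even : parity false d) (z_even : parity false z).
Hypothesis z_central : central z.
Hypothesis d_notin : ~ derived_alg d.
Hypothesis derived_line : forall x, exists c : K, derived_alg (x - c *: d).

Lemma derived_coord0 (c : K) : derived_alg (c *: d) -> c = 0.
Proof.
move=> hc; apply/eqP/negPn/negP => c0; apply: d_notin.
by rewrite -[d]scale1r -(mulVf c0) -scalerA; apply: lin_spanZ.
Qed.

Lemma semidirect_derived_line : semidirect_sum (@derived_alg K L) (line d).
Proof.
split.
- exact: ideal_derived.
- split.
  + split; first by exists 0; rewrite scale0r.
    move=> c x y [a ->] [b ->]; exists (c * a + b).
    by rewrite scalerDl scalerA.
  + by move=> x [a ->]; exists 0; rewrite linearZ /= d_even scaler0 scale0r.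
  + move=> x y [a ->] [b ->]; exists 0.
    by rewrite brZ brZl even_bracket_self // !scaler0 scale0r.
  + move=> x [a ->]; exists 0; rewrite squaring_odd_part linearZ /= d_even.
    by rewrite scaler0 squaring0 scale0r.
- move=> x; have [c hc] := derived_line x.
  by exists (x - c *: d), (c *: d); split; rewrite ?subrK //; exists c.
- by move=> x hx [c ex]; rewrite ex in hx *; rewrite (derived_coord0 hx) scale0r.
Qed.

(** The coefficient of [d] modulo the derived algebra is chosen arbitrarily, but [derived_coord0]
    makes it unique, and uniqueness makes it linear. *)
Lemma exists_derived_line_map : exists M : {linear L -> L},
  M d = z /\ forall x, derived_alg x -> M x = 0.
Proof.
have [f hf] := choice derived_line.
have f_uniq x c : derived_alg (x - c *: d) -> f x = c.
  move=> hc; apply/eqP; rewrite -subr_eq0; apply/eqP/derived_coord0.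
  have -> : (f x - c) *: d = (x - c *: d) - (x - f x *: d).
    by rewrite scalerBl opprB [RHS]addrC addrA subrK.
  exact: lin_spanD hc (lin_spanN (hf x)).
have [M hM] : exists M : {linear L -> L}, M =1 (fun x => f x *: z).
  apply: linear_bundle => a x y; rewrite scalerA -scalerDl; congr (_ *: _).
  apply: f_uniq.
  have -> : a *: x + y - (a * f x + f y) *: d =
      a *: (x - f x *: d) + (y - f y *: d).
    by rewrite scalerBr scalerA scalerDl opprD addrACA.
  exact: lin_spanD (lin_spanZ _ (hf x)) (hf y).
exists M; split=> [|x hx]; rewrite hM.
  by rewrite (f_uniq _ 1) ?scale1r // subrr; apply: lin_span0.
by rewrite (f_uniq _ 0) ?scale0r // subr0.
Qed.

Lemma derived_line_map_derivation (M : {linear L -> L}) :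
  M d = z -> (forall x, derived_alg x -> M x = 0) -> derivation M.
Proof.
move=> Md M0.
have Mline x : exists2 c : K, derived_alg (x - c *: d) & M x = c *: z.
  have [c hc] := derived_line x; exists c => //.
  by rewrite -[x in LHS](subrK (c *: d)) linearD /= M0 // add0r linearZ /= Md.
have zl x y : [M x ,, y] = 0.
  by have [c _ ->] := Mline x; rewrite brZl z_central scaler0.
(* [central] is one-sided; evenness of [z] gives the other side. *)
have zr x y : [x ,, M y] = 0.
  have [c _ ->] := Mline y.
  by rewrite brZ -[[x ,, z]]opprK -even_bracketC // z_central oppr0 scaler0.
(* M is purely even: [z] is even, and odd elements lie in the derived algebra, as odd parts of
   elements x - c d. *)
exists M, \0; split; last by move=> x; rewrite addr0.
- split=> [a x|a x y _|_ x _].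
  + case: a => /= hx; rewrite /homog; last first.
      by have [c _ ->] := Mline x; rewrite linearZ /= z_even scaler0.
    have [c hc _] := Mline x.
    have /M0 : derived_alg x.
      have -> : x = odd_part (x - c *: d).
        by rewrite linearB linearZ /= d_even scaler0 subr0 hx.
      exact: derived_odd_part.
    by move=> ->; rewrite linear0.
  + by rewrite zl zr scaler0 addr0 M0 //; apply: derived_bracket.
  + by rewrite zl M0 //; apply: derived_squaring.
- split=> [a x _|a x y _|_ x _] /=; rewrite ?br0l ?linear0 ?scaler0 ?addr0 //.
  by rewrite /homog linear0; case: (~~ a).
Qed.

Lemma derived_line_map_outer (M : {linear L -> L}) :
  z <> 0 -> ad_diagonalizable d ->
  M d = z -> (forall x, derived_alg x -> M x = 0) -> outer_derivation M.
Proof.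
move=> z0 diag Md M0; split; first exact: derived_line_map_derivation.
case=> x Mx; have dx : [d ,, x] = - z by rewrite even_bracketC // -Mx Md.
apply: z0; rewrite -[z]opprK -dx ad_diagonalizable_ker_im ?oppr0 //.
by rewrite dx linearN /= even_bracketC // z_central !oppr0.
Qed.

End OuterDerivation.
End LinSpan.

(** * The algebra g(A): generators, diagonalizability, and codimension of g' *)

Section CartanAlgebraTheory.
Variables (K : fieldType) (n : nat) (A : 'M[K]_n) (R : realization A).
Variable par : 'I_n -> bool.
Let g := cartan_alg R par.
Let H := cartan_h R par.
Let X := cartan_x R par.
Let Y := cartan_y R par.

Lemma cartan_h_even h : parity false (H h).
Proof. by rewrite /homog -lie_proj_odd tilde_h_even linear0. Qed.

Lemma cartan_hh h h' : [H h ,, H h'] = 0.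
Proof. by rewrite -lie_proj_bracket tilde_hh linear0. Qed.

Lemma cartan_hx h j : [H h ,, X j] = rootv j h *: X j.
Proof. by rewrite -lie_proj_bracket tilde_hx linearZ. Qed.

Lemma cartan_hy h j : [H h ,, Y j] = - (rootv j h *: Y j).
Proof. by rewrite -lie_proj_bracket tilde_hy linearN linearZ. Qed.

Lemma cartan_xy i : [X i ,, Y i] = H (coroot R i).
Proof. by rewrite -lie_proj_bracket tilde_xy eqxx. Qed.

(** The preimage of [S] under the projection is a subalgebra of the presented algebra, so
    [tilde_generated] descends to the quotient. *)
Lemma cartan_generated (S : set g) : sub_superalgebra S ->
  (forall h, S (H h)) -> (forall i, S (X i)) -> (forall i, S (Y i)) ->
  forall x, S x.
Proof.
case=> -[S0 SP] SO SB SS Sh Sx Sy x; rewrite -(prepK x).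
set I := max_idealP R par.
apply: (@tilde_generated K n A R par (fun t => S (lie_proj I t))) => //.
split.
- split; first by rewrite linear0.
  by move=> c u v hu hv; rewrite linearP; apply: SP.
- by move=> u hu; rewrite lie_proj_odd; apply: SO.
- by move=> u v hu hv; rewrite lie_proj_bracket; apply: SB.
- by move=> u hu; rewrite lie_proj_squaring; apply: SS.
Qed.

(** All the generators are eigenvectors, and eigenvectors span a subalgebra. *)
Lemma cartan_h_diagonalizable h : ad_diagonalizable (H h).
Proof.
apply: cartan_generated => [|h'|i|i].
- exact/sub_superalgebra_eigen/cartan_h_even.
- by apply: lin_span_incl; exists 0; rewrite cartan_hh scale0r.
- by apply: lin_span_incl; exists (rootv i h); rewrite cartan_hx.
- by apply: lin_span_incl; exists (- rootv i h); rewrite cartan_hy scaleNr.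
Qed.

Lemma root_neq0 i : exists h : torus R, rootv i h != 0.
Proof.
apply: contrapT => h0.
have := free_not0 (root_free R) (map_f _ (mem_enum 'I_n i)).
case/eqP; apply/lfunP => h; rewrite lfunE /=.
by apply: contrapT => /eqP hh; apply: h0; exists h.
Qed.

Lemma derived_cartan_x i : derived_alg (X i).
Proof.
have [h h0] := root_neq0 i.
rewrite -[X i]scale1r -(mulVf h0) -scalerA -cartan_hx.
exact/lin_spanZ/derived_bracket.
Qed.

Lemma derived_cartan_y i : derived_alg (Y i).
Proof.
have [h h0] := root_neq0 i.
rewrite -[Y i]scale1r -(mulVf h0) -scalerA -[_ *: Y i]opprK -cartan_hy.
exact/lin_spanZ/lin_spanN/derived_bracket.
Qed.

Lemma derived_coroot_span h :
  h \in <<[seq coroot R i | i <- enum 'I_n]>>%VS -> derived_alg (H h).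
Proof.
set s := map _ _ => hs; rewrite (coord_span (X := in_tuple s) hs) linear_sum.
elim/big_ind: _ => [||i _]; [exact: lin_span0 | exact: lin_spanD |].
rewrite linearZ; apply: lin_spanZ.
have /mapP[j _ ->] : (in_tuple s)`_i \in s by rewrite mem_nth.
rewrite -cartan_xy; exact: derived_bracket.
Qed.

(** The torus has dimension 2n - (n - 1) = n + 1. As [D] is outside the span of the coroots, [D] and
    the n coroots form a basis of it. Elements of g' + K D are closed under brackets and squares,
    which land in g', so checking generators suffices. *)
Lemma cartan_derived_line (hA : (\rank A).+1 = n) (D : torus R) :
  ~ derived_alg (H D) ->
  forall x : g, exists c : K, derived_alg (x - c *: H D).
Proof.
move=> HD.
have full : ({:torus R} <= <<D :: [seq coroot R i | i <- enum 'I_n]>>)%VS.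
  set s := map _ _.
  have fs : free (D :: s).
    by rewrite free_cons coroot_free andbT; apply/negP => /derived_coroot_span.
  rewrite -(geq_leqif (dimv_leqif_sup (subvf _))) (eqP fs) /= size_map.
  by rewrite size_enum_ord torus_dim leq_subLR addnS -addSn hA addnn mul2n.
apply: cartan_generated.
- split.
  + split; first by exists 0; rewrite scale0r subr0; apply: lin_span0.
    move=> a x y [b hb] [c hc]; exists (a * b + c).
    rewrite scalerDl opprD addrACA -scalerA -scalerBr.
    by apply: lin_spanD hc; apply: lin_spanZ.
  + move=> x [c hc]; exists 0; rewrite scale0r subr0.
    have -> : odd_part x = odd_part (x - c *: H D).
      by rewrite linearB linearZ /= cartan_h_even scaler0 subr0.
    exact: derived_odd_part.
  + by move=> x y _ _; exists 0; rewrite scale0r subr0; apply: derived_bracket.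
  + by move=> x _; exists 0; rewrite scale0r subr0; apply: derived_squaring.
- move=> h; have := subvP full h (memvf h); rewrite span_cons.
  case/memv_addP=> _ /vlineP[c ->] [v hv ->]; exists c.
  by rewrite linearD linearZ addrAC subrr add0r; apply: derived_coroot_span.
- by move=> i; exists 0; rewrite scale0r subr0; apply: derived_cartan_x.
- by move=> i; exists 0; rewrite scale0r subr0; apply: derived_cartan_y.
Qed.

End CartanAlgebraTheory.

Theorem mainTheorem1 (K : closedFieldType) (p : nat) (hp : p \in [pchar K])
    (n : nat) (A : 'M[K]_n) (hA : (\rank A).+1 = n)
    (par : 'I_n -> bool) (R : realization A) (z D : torus R)
    (z_neq0 : cartan_h R par z <> 0)
    (z_central : central (cartan_h R par z))
    (D_notin : ~ derived_alg (cartan_h R par D))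
    (D_grading : grading_element par D) :
  let g := cartan_alg R par in
  let is_M (M : {linear g -> g}) : Prop :=
    M (cartan_h R par D) = cartan_h R par z /\
    forall x : g, derived_alg x -> M x = 0 in
  [/\ semidirect_sum (@derived_alg K g) (line (cartan_h R par D)),
      exists M : {linear g -> g}, is_M M &
      forall M : {linear g -> g}, is_M M -> outer_derivation M].
Proof.
move=> g is_M; have D0 := cartan_h_even par D; have z0 := cartan_h_even par z.
have gD := cartan_derived_line hA D_notin.
split; first exact: semidirect_derived_line.
  exact: exists_derived_line_map.
move=> M [MD M0]; apply: (derived_line_map_outer D0 z0) => //.
exact: cartan_h_diagonalizable.
Qed.
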